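(* Let $\mathcal{D}_{\mathrm{val}}$ be a finite set of size $k$, let $S\subseteq\mathcal{D}_{\mathrm{train}}$ be a nonempty finite set, and let $g(v)\in\mathbb{R}^d$ be the (gradient) vector attached to each $v\in\mathcal{D}_{\mathrm{val}}\cup S$. Let $\gamma>0$, $\lambda>0$, and define $$\mathcal{I}_\gamma(S):=\sum_{z\in S} g(z)g(z)^\top+\gamma I_d,\qquad G_\gamma(S):=\sum_{x\in\mathcal{D}_{\mathrm{val}}} g(x)^\top \mathcal{I}_\gamma(S)^{-1} g(x),$$ $$U_\lambda(S):=\sum_{x\in\mathcal{D}_{\mathrm{val}}}\max_{z\in S}\exp\big(-\lambda\|g(x)-g(z)\|^2\big).$$ Assume that (i) $\|g(v)\|\le L$ for all $v\in\mathcal{D}_{\mathrm{val}}\cup S$, and (ii) $\|g(z)\|\ge m>0$ for all $z\in S$. Then for every $\tau\in(0,2m^2]$, $$G_\gamma(S)\;\le\;\frac{kL^2}{\gamma}\;-\;\frac{(2m^2-\tau)^2}{4\gamma^2\left(1+\frac{L^2}{\gamma}\right)}\cdot\frac{U_\lambda(S)-k\,e^{-\lambda\tau}}{1-e^{-\lambda\tau}}.$$ In particular, for fixed $\lambda,\tau,\gamma$ (and $k,L,m$), the right-hand side is a nonincreasing function of the value $U_\lambda(S)$.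
   Context: $\mathcal{D}_{\mathrm{val}}$ is a fixed validation set and $\mathcal{D}_{\mathrm{train}}$ a set of candidate training samples. For each data point $v$, $g(v)\in\mathbb{R}^d$ denotes the gradient of a model's loss at $v$, evaluated at a common fixed parameter $\theta_{\mathrm{anchor}}$; for the statement only the vectors $g(v)$ matter. $I_d$ is the $d\times d$ identity matrix and $\|\cdot\|$ is the Euclidean norm. $\mathcal{I}_\gamma(S)$ is called the regularized empirical Fisher information, $G_\gamma(S)$ the regularized total uncertainty, and $U_\lambda(S)$ the gradient-coverage surrogate. *)

(* Defs.v *)
From mathcomp Require Import all_boot all_order all_algebra finmap.
From mathcomp Require Import all_classical all_reals all_analysis.

Set Implicit Arguments.
Unset Strict Implicit.
Unset Printing Implicit Defensive.

Import Order.TTheory GRing.Theory Num.Theory.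

Local Open Scope ring_scope.

(* Needed because the library norm `|v| on matrices is the sup norm. *)
Definition eucl_norm (R : realType) (d : nat) (v : 'cV[R]_d) : R :=
  Num.sqrt (\sum_(i < d) v i 0 ^+ 2).

Section Selection.
Context (R : realType) (T : choiceType) (d : nat) (g : T -> 'cV[R]_d).

Definition fisher (gamma : R) (S : {fset T}) : 'M[R]_d :=
  \sum_(z <- S) g z *m (g z)^T + gamma%:M.

(* For gamma > 0 the matrix fisher gamma S is positive definite, so invmx is
   its genuine inverse; the entry (0, 0) reads off the 1 x 1 product. *)
Definition total_uncertainty (gamma : R) (Dval S : {fset T}) : R :=
  \sum_(x <- Dval) ((g x)^T *m invmx (fisher gamma S) *m g x) 0 0.

(* As the exponentials are positive, the default value 0 of the iterated max
   is only reached for empty S. *)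
Definition coverage (lambda : R) (Dval S : {fset T}) : R :=
  \sum_(x <- Dval)
    \big[Num.max/0]_(z <- S) expR (- lambda * eucl_norm (g x - g z) ^+ 2).

End Selection.

Definition uncertainty_bound (R : realType) (k : nat)
    (L m gamma lambda tau u : R) : R :=
  k%:R * L ^+ 2 / gamma
  - (2 * m ^+ 2 - tau) ^+ 2 / (4 * gamma ^+ 2 * (1 + L ^+ 2 / gamma))
    * ((u - k%:R * expR (- lambda * tau)) / (1 - expR (- lambda * tau))).

(* Main.v *)
(** Write [A] for the Fisher matrix and [y = A^-1 x], so that
    [x^T A^-1 x = 2 (x . y) - y^T A y].  Keeping a single sample [z] in [A] gives
    [y^T A y >= gamma |y|^2 + (z . y)^2], and maximizing the resulting concave
    function of [y] yields the rank-one (Sherman-Morrison) bound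
    [x^T A^-1 x <= |x|^2 / gamma - (x . z)^2 / (gamma (gamma + |z|^2))].
    If the similarity of [x] and [z] exceeds [exp (- lambda tau)], then
    [|x - z|^2 <= tau].  When [|x| >= m] this gives [x . z >= m^2 - tau / 2];
    when [|x| < m] it may fail, but the loss is absorbed by the slack
    [L^2 - |x|^2] in the main term.  The bound on each validation point is then
    linear in its coverage, and one sums over the validation set. *)
Require Import Defs.
From mathcomp Require Import all_boot all_order all_algebra finmap.
From mathcomp Require Import all_classical all_reals all_analysis.
From mathcomp Require Import ring lra.

Set Implicit Arguments.
Unset Strict Implicit.
Unset Printing Implicit Defensive.

Import Order.TTheory GRing.Theory Num.Theory.

Local Open Scope ring_scope.

Definition dotmx (R : realFieldType) (d : nat) (u v : 'cV[R]_d) : R :=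
  (u^T *m v) 0 0.

Section Dot.
Context (R : realFieldType) (d : nat).
Implicit Types u v w : 'cV[R]_d.

Lemma dotmxE u v : dotmx u v = \sum_i u i 0 * v i 0.
Proof. by rewrite /dotmx mxE; apply: eq_bigr => i _; rewrite mxE. Qed.

Lemma dotmxC u v : dotmx u v = dotmx v u.
Proof. by rewrite !dotmxE; apply: eq_bigr => i _; rewrite mulrC. Qed.

Lemma dotmxBl u v w : dotmx (u - v) w = dotmx u w - dotmx v w.
Proof. by rewrite /dotmx linearB mulmxBl !mxE. Qed.

Lemma dotmxBr u v w : dotmx w (u - v) = dotmx w u - dotmx w v.
Proof. by rewrite dotmxC dotmxBl !(dotmxC w). Qed.

Lemma dotmxZl a u v : dotmx (a *: u) v = a * dotmx u v.
Proof. by rewrite /dotmx linearZ -scalemxAl !mxE. Qed.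

Lemma dotmxZr a u v : dotmx u (a *: v) = a * dotmx u v.
Proof. by rewrite dotmxC dotmxZl dotmxC. Qed.

Lemma dotmx_ge0 u : 0 <= dotmx u u.
Proof. by rewrite dotmxE; apply: sumr_ge0 => i _; rewrite -expr2 sqr_ge0. Qed.

Lemma dotmx_eq0 u : (dotmx u u == 0) = (u == 0).
Proof.
apply/idP/eqP => [|->]; last by rewrite dotmxE big1 // => i _; rewrite mxE mul0r.
rewrite dotmxE psumr_eq0 => [/allP u0|i _]; last by rewrite -expr2 sqr_ge0.
apply/matrixP => i j; rewrite ord1 mxE; apply/eqP.
by have := u0 i (mem_index_enum i); rewrite /= mulf_eq0 orbb.
Qed.

(* The square [|x - gamma y - c z|^2] with the optimal
   [c = (x . z) / (gamma + |z|^2)] does the maximization over [y]. *)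
Lemma rank_one_concave_max (gamma : R) (x y z : 'cV[R]_d) : 0 < gamma ->
  2 * dotmx x y - (gamma * dotmx y y + dotmx z y ^+ 2)
    <= dotmx x x / gamma - dotmx x z ^+ 2 / (gamma * (gamma + dotmx z z)).
Proof.
move=> gamma_gt0.
have den_gt0 : 0 < gamma + dotmx z z by rewrite ltr_wpDr ?dotmx_ge0.
have [c xzE] : exists c, dotmx x z = c * (gamma + dotmx z z).
  by exists (dotmx x z / (gamma + dotmx z z)); rewrite divfK ?gt_eqF.
rewrite xzE [leRHS](_ : _ = (dotmx x x - c ^+ 2 * (gamma + dotmx z z)) / gamma);
  last by field; rewrite !gt_eqF.
rewrite ler_pdivlMr //.
have := dotmx_ge0 (x - gamma *: y - c *: z).
rewrite !(dotmxBl, dotmxBr, dotmxZl, dotmxZr).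
rewrite (dotmxC y x) (dotmxC z x) (dotmxC y z) xzE.
(* The goal minus the expanded square is exactly [gamma * (dotmx z y - c) ^+ 2]. *)
have := mulr_ge0 (ltW gamma_gt0) (sqr_ge0 (dotmx z y - c)).
by lra.
Qed.

End Dot.

Lemma eucl_norm_ge0 (R : realType) (d : nat) (v : 'cV[R]_d) : 0 <= eucl_norm v.
Proof. exact: sqrtr_ge0. Qed.

Lemma eucl_norm_sqr (R : realType) (d : nat) (v : 'cV[R]_d) :
  eucl_norm v ^+ 2 = dotmx v v.
Proof.
have normE : \sum_(i < d) v i 0 ^+ 2 = dotmx v v.
  by rewrite dotmxE; apply: eq_bigr => i _; rewrite expr2.
by rewrite /eucl_norm normE sqr_sqrtr ?dotmx_ge0.
Qed.

Section Fisher.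
Context (R : realType) (T : choiceType) (d : nat) (g : T -> 'cV[R]_d).
Context (gamma : R) (S : {fset T}) (gamma_gt0 : 0 < gamma).

Lemma fisher_quad (y : 'cV[R]_d) :
  dotmx y (fisher g gamma S *m y)
    = \sum_(z <- S) dotmx (g z) y ^+ 2 + gamma * dotmx y y.
Proof.
rewrite /dotmx /fisher mulmxDl mulmxDr mxE mul_scalar_mx -scalemxAr.
rewrite [in X in _ + X]mxE; congr (_ + _).
rewrite mulmx_suml mulmx_sumr summxE; apply: eq_bigr => z _.
rewrite -mulmxA (mulmxA y^T) mxE big_ord1 expr2; congr (_ * _).
exact: dotmxC.
Qed.

(** A kernel vector annihilates the quadratic form, whose term [gamma * dotmx v v] then forces the
    vector to vanish. *)
Lemma fisher_unit : fisher g gamma S \in unitmx.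
Proof.
rewrite -row_free_unit; apply: inj_row_free => v vA0.
have /eqP : dotmx v^T (fisher g gamma S *m v^T) = 0.
  by rewrite /dotmx mulmxA trmxK vA0 mul0mx mxE.
have sum_ge0 : 0 <= \sum_(z <- S) dotmx (g z) v^T ^+ 2.
  by apply: sumr_ge0 => z _; exact: sqr_ge0.
rewrite fisher_quad paddr_eq0 ?(mulr_ge0 (ltW gamma_gt0)) ?dotmx_ge0 //.
rewrite mulf_eq0 (gt_eqF gamma_gt0) /= dotmx_eq0 => /andP[_ /eqP v0].
by rewrite -[v]trmxK v0 trmx0.
Qed.

(** Since [fisher g gamma S *m y = x], the linear and quadratic terms in [y] coincide. In this
    shape, discarding samples only increases the right-hand side. *)
Lemma uncertainty_quad (x : 'cV[R]_d) :
  let y := invmx (fisher g gamma S) *m x in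
  (x^T *m invmx (fisher g gamma S) *m x) 0 0
    = 2 * dotmx x y - (gamma * dotmx y y + \sum_(z <- S) dotmx (g z) y ^+ 2).
Proof.
move=> y; rewrite -mulmxA -/(dotmx x y).
have xE : fisher g gamma S *m y = x by rewrite mulmxA mulmxV ?fisher_unit ?mul1mx.
by have := fisher_quad y; rewrite xE dotmxC => yE; lra.
Qed.

Lemma uncertainty_le_sqr (x : 'cV[R]_d) :
  (x^T *m invmx (fisher g gamma S) *m x) 0 0 <= dotmx x x / gamma.
Proof.
rewrite uncertainty_quad; set y := _ *m x.
have sum_ge0 : 0 <= \sum_(z <- S) dotmx (g z) y ^+ 2.
  by apply: sumr_ge0 => z _; exact: sqr_ge0.
have z0 (v : 'cV[R]_d) : dotmx v 0 = 0 by rewrite -(scale0r v) dotmxZr mul0r.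
(* Taking the zero vector as sample leaves only the regularization. *)
have := rank_one_concave_max x y 0 gamma_gt0.
by rewrite (dotmxC 0) !z0 expr0n /= mul0r subr0 addr0; lra.
Qed.

Lemma uncertainty_le_rank_one (x : 'cV[R]_d) (z : T) : z \in S ->
  (x^T *m invmx (fisher g gamma S) *m x) 0 0
    <= dotmx x x / gamma
       - dotmx x (g z) ^+ 2 / (gamma * (gamma + dotmx (g z) (g z))).
Proof.
move=> zS; rewrite uncertainty_quad; set y := _ *m x.
apply: le_trans (rank_one_concave_max x y (g z) gamma_gt0).
rewrite lerD2l lerN2 lerD2l (big_fsetD1 z) //= lerDl.
by apply: sumr_ge0 => t _; exact: sqr_ge0.
Qed.

End Fisher.

(* [a], [b], [p], [t] stand for [|x|^2], [|z|^2], [x . z] and [|x - z|^2], and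
   [M], [N] for [m^2], [L^2].  The term [(N - a) * N] is what compensates for a
   validation gradient shorter than [m]. *)
Lemma alignment_bound (R : realFieldType) (a b p t tau M N : R) :
  2 * p = a + b - t -> 0 <= a -> a <= N -> M <= b -> b <= N ->
  0 <= M -> t <= tau -> 0 <= tau -> tau <= 2 * M ->
  (2 * M - tau) ^+ 2 / 4 <= p ^+ 2 + (N - a) * N.
Proof.
move=> pE a_ge0 aN Mb bN M_ge0 t_tau tau_ge0 tauM.
have [Ma|aM] := leP M a.
  have : (M - tau / 2) ^+ 2 <= p ^+ 2 by rewrite ler_sqr ?nnegrE; lra.
  have : 0 <= (N - a) * N by apply: mulr_ge0; lra.
  by lra.
have slack : (M - a) * M <= (N - a) * N by apply: ler_pM; lra.
(* With [D = M - a], the hypotheses give [p >= (M - tau / 2) - D / 2]. If this lower bound is not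
   positive, it says nothing about [p ^+ 2], but then [D * M] alone suffices. *)
have [c_le|c_gt] := leP (M - tau / 2) ((M - a) / 2).
  have : (M - tau / 2) ^+ 2 <= ((M - a) / 2) ^+ 2 by rewrite ler_sqr ?nnegrE; lra.
  have := sqr_ge0 p.
  have : (M - a) ^+ 2 <= (M - a) * M by rewrite expr2 ler_wpM2l; lra.
  have := sqr_ge0 (M - a).
  by lra.
(* Squaring the lower bound loses at most [D * (M - tau / 2)], which [D * M] covers. *)
have : (M - tau / 2 - (M - a) / 2) ^+ 2 <= p ^+ 2 by rewrite ler_sqr ?nnegrE; lra.
have : 0 <= tau * (M - a) by apply: mulr_ge0; lra.
have := sqr_ge0 (M - a).
by lra.
Qed.

Lemma uncertainty_le_coverage (R : realType) (T : choiceType) (d : nat)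
    (S : {fset T}) (g : T -> 'cV[R]_d) (gamma lambda L m tau : R) (x : 'cV[R]_d) :
  0 < gamma -> 0 < lambda -> 0 < m -> 0 < tau -> tau <= 2 * m ^+ 2 ->
  eucl_norm x <= L ->
  (forall z, z \in S -> m <= eucl_norm (g z) <= L) ->
  (x^T *m invmx (fisher g gamma S) *m x) 0 0
    <= L ^+ 2 / gamma
       - (2 * m ^+ 2 - tau) ^+ 2 / (4 * gamma ^+ 2 * (1 + L ^+ 2 / gamma))
         * ((\big[Num.max/0]_(z <- S) expR (- lambda * eucl_norm (x - g z) ^+ 2)
              - expR (- lambda * tau)) / (1 - expR (- lambda * tau))).
Proof.
move=> gamma_gt0 lambda_gt0 m_gt0 tau_gt0 tau_le xL gS.
have e_lt1 : expR (- lambda * tau) < 1 by rewrite expR_lt1 mulNr oppr_lt0 mulr_gt0.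
have L2_ge0 : 0 <= L ^+ 2 by exact: sqr_ge0.
have xL2 : dotmx x x <= L ^+ 2.
  rewrite -eucl_norm_sqr lerXn2r ?nnegrE ?eucl_norm_ge0 //.
  by rewrite (le_trans _ xL) ?eucl_norm_ge0.
(* This is the rank-one denominator with [|z|^2] replaced by its upper bound [L ^+ 2]. *)
have CE : (2 * m ^+ 2 - tau) ^+ 2 / (4 * gamma ^+ 2 * (1 + L ^+ 2 / gamma))
    = (2 * m ^+ 2 - tau) ^+ 2 / 4 / (gamma * (gamma + L ^+ 2)).
  by field; rewrite !gt_eqF //= ltr_wpDr.
rewrite {}CE.
set C := _ / (gamma * _); set u := \big[_/_]_(_ <- _) _; set w := _ / (1 - _).
have den_gt0 : 0 < gamma * (gamma + L ^+ 2) by rewrite mulr_gt0 ?ltr_wpDr.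
have C_ge0 : 0 <= C.
  by rewrite divr_ge0 ?(ltW den_gt0) // divr_ge0 ?sqr_ge0.
(* At low coverage [w <= 0], so the bound without samples is enough. *)
have [u_le|u_gt] := leP u (expR (- lambda * tau)).
  apply: le_trans (uncertainty_le_sqr g S gamma_gt0 x) _.
  have : C * w <= 0.
    by rewrite mulr_ge0_le0 // mulr_le0_ge0 ?subr_le0 // invr_ge0 subr_ge0 ltW.
  have : dotmx x x / gamma <= L ^+ 2 / gamma by rewrite ler_pM2r ?invr_gt0.
  by lra.
have w_le1 : w <= 1.
  rewrite ler_pdivrMr ?subr_gt0 // mul1r lerD2r.
  apply: bigmax_le => // z _.
  by rewrite expR_le1 mulNr oppr_le0 mulr_ge0 ?sqr_ge0 // ltW.
(* The threshold is positive, so the default 0 of the maximum cannot exceed it and some sample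
   must. *)
have [z zS z_close] : exists2 z, z \in S & dotmx (x - g z) (x - g z) <= tau.
  apply: contrapT => far; move: u_gt; apply/negP; rewrite -leNgt.
  rewrite /u big_seq; apply: bigmax_le => [|z zS]; first exact: expR_ge0.
  rewrite ler_expR !mulNr lerN2 ler_pM2l // eucl_norm_sqr leNgt.
  by apply/negP => /ltW z_close; apply: far; exists z.
have /andP[mz zL] := gS z zS.
have mz2 : m ^+ 2 <= dotmx (g z) (g z).
  by rewrite -eucl_norm_sqr lerXn2r ?nnegrE ?eucl_norm_ge0 // ltW.
have zL2 : dotmx (g z) (g z) <= L ^+ 2.
  rewrite -eucl_norm_sqr lerXn2r ?nnegrE ?eucl_norm_ge0 //.
  by rewrite (le_trans _ zL) ?eucl_norm_ge0.
have pE : 2 * dotmx x (g z)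
    = dotmx x x + dotmx (g z) (g z) - dotmx (x - g z) (x - g z).
  by rewrite !(dotmxBl, dotmxBr) (dotmxC (g z) x); ring.
have align := alignment_bound pE (dotmx_ge0 x) xL2 mz2 zL2 (sqr_ge0 m) z_close
  (ltW tau_gt0) tau_le.
apply: le_trans (uncertainty_le_rank_one g gamma_gt0 x zS) _.
have Cw_le : C * w <= C by rewrite ler_piMr.
have p_le : dotmx x (g z) ^+ 2 / (gamma * (gamma + L ^+ 2))
    <= dotmx x (g z) ^+ 2 / (gamma * (gamma + dotmx (g z) (g z))).
  rewrite ler_wpM2l ?sqr_ge0 // lef_pV2 ?posrE //; last first.
    by rewrite mulr_gt0 // ltr_wpDr ?dotmx_ge0.
  by rewrite ler_pM2l // lerD2l.
(* Clearing denominators turns the slack into [(L ^+ 2 - |x|^2) * (gamma + L ^+ 2)], which dominates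
   the compensation term in [align]. *)
have : C <= dotmx x (g z) ^+ 2 / (gamma * (gamma + L ^+ 2))
            + (L ^+ 2 / gamma - dotmx x x / gamma).
  rewrite ler_pdivrMr // [leRHS]mulrDl divfK ?gt_eqF // -mulrBl.
  rewrite (mulrA _ gamma) divfK ?gt_eqF //.
  apply: (le_trans align); rewrite lerD2l ler_wpM2l ?subr_ge0 //.
  by rewrite lerDr ltW.
by lra.
Qed.

Lemma uncertainty_bound_nonincreasing (R : realType) (k : nat)
    (L m gamma lambda tau : R) :
  0 < gamma -> 0 < lambda -> 0 < tau ->
  {homo uncertainty_bound k L m gamma lambda tau : u v /~ u <= v}.
Proof.
move=> gamma_gt0 lambda_gt0 tau_gt0 u v uv; rewrite /uncertainty_bound.
have e_lt1 : expR (- lambda * tau) < 1 by rewrite expR_lt1 mulNr oppr_lt0 mulr_gt0.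
rewrite lerD2l lerN2 ler_wpM2l //; last first.
  by rewrite ler_pM2r ?invr_gt0 ?subr_gt0 // lerD2r.
have ratio_ge0 : 0 <= L ^+ 2 / gamma by rewrite divr_ge0 ?sqr_ge0 // ltW.
by rewrite divr_ge0 ?sqr_ge0 // mulr_ge0 ?addr_ge0 // mulr_ge0 ?sqr_ge0.
Qed.

Local Open Scope fset_scope.

Theorem theorem1 (R : realType) (T : choiceType) (d k : nat)
    (Dval : {fset T}) (Dtrain : set T) (S : {fset T})
    (g : T -> 'cV[R]_d) (gamma lambda L m : R)
    (card_Dval : #|` Dval| = k)
    (S_train : forall z, z \in S -> Dtrain z)
    (S_neq0 : S != fset0)
    (gamma_gt0 : 0 < gamma) (lambda_gt0 : 0 < lambda)
    (g_le : forall v, v \in Dval `|` S -> eucl_norm (g v) <= L)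
    (m_gt0 : 0 < m)
    (g_ge : forall z, z \in S -> m <= eucl_norm (g z)) :
  forall tau : R, 0 < tau -> tau <= 2 * m ^+ 2 ->
    total_uncertainty g gamma Dval S
      <= uncertainty_bound k L m gamma lambda tau (coverage g lambda Dval S)
    /\ {homo uncertainty_bound k L m gamma lambda tau : u v /~ u <= v}.
Proof.
move=> tau tau_gt0 tau_le; split; last exact: uncertainty_bound_nonincreasing.
(* Spreading the constants over [Dval] reduces the inequality to one validation point. *)
have sum_const (c : R) : k%:R * c = \sum_(x <- Dval) c.
  by rewrite -card_Dval big_const_seq count_predT iter_addr_0 mulr_natl.
rewrite /total_uncertainty /uncertainty_bound /coverage -mulrA !sum_const.
rewrite -sumrB mulr_suml mulr_sumr -sumrB big_seq [leRHS]big_seq.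
apply: ler_sum => x xD; apply: uncertainty_le_coverage => // [|z zS].
  by apply: g_le; rewrite inE xD.
by rewrite g_ge //= g_le // inE zS orbT.
Qed.
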